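(* There is a deterministic algorithm that, given a tournament $T$ on $n$ vertices, a set $S\subseteq V(T)$ and an integer $k$, decides whether there exists $F\subseteq A(T)$ with $|F|\le k$ such that $T-F$ contains no $S$-cycle (i.e. solves Subset-FAST), in time $2^{\mathcal{O}(\sqrt{k}\log k)} + n^{\mathcal{O}(1)}$.
   Context: A tournament is a directed graph with exactly one arc between every pair of distinct vertices. For a directed graph $D$ and $S\subseteq V(D)$, an $S$-cycle is a directed cycle containing at least one vertex of $S$. $T-F$ denotes the digraph obtained from $T$ by deleting the arcs of $F$. *)

(* Defs.v *)
From mathcomp Require Import all_boot.

Set Implicit Arguments.
Unset Strict Implicit.
Unset Printing Implicit Defensive.

(* A digraph is given by its arc relation: e x y holds when there is an arc   *)
(* from x to y.                                                               *)
Section Digraphs.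
Variable V : finType.
Implicit Types (e : rel V) (F : {set V * V}) (S : {set V}).

Definition tournament e : Prop :=
  irreflexive e /\ forall x y, x != y -> e x y (+) e y x.

Definition arcs e : {set V * V} := [set a | e a.1 a.2].

Definition delete_arcs e F : rel V := [rel x y | e x y && ((x, y) \notin F)].

(* A directed cycle is the nonempty sequence of its pairwise distinct         *)
(* vertices, each having an arc to the next and the last one to the first.    *)
Definition dicycle e (c : seq V) : Prop := c <> [::] /\ ucycle e c.

Definition S_cycle e S (c : seq V) : Prop := dicycle e c /\ has (mem S) c.

Definition subset_FAST e S (k : nat) : Prop :=
  exists F : {set V * V},
    [/\ F \subset arcs e, #|F| <= k
      & ~ exists c, S_cycle (delete_arcs e F) S c].

End Digraphs.

(* The model of computation is a unit-cost random access machine without      *)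
(* multiplication, programmed by while programs.  A state consists of         *)
(* registers and of an indirectly addressable memory, whose cells contain     *)
(* natural numbers.  Addition and truncated subtraction being the only        *)
(* arithmetic operations, t steps lengthen a number by at most t bits plus a  *)
(* constant, so that time is polynomially related to that of Turing machines; *)
(* bounds of the form 2^O(sqrt k log k) + n^O(1) are stable under polynomials.*)
Record state := State { regs : nat -> nat; memory : nat -> nat }.

Inductive expr :=
| Const of nat
| Reg of nat
| Mem of expr
| Add of expr & expr
| Sub of expr & expr.

Inductive prog :=
| Skip
| Assign of nat & expr
| Store of expr & expr
| Seq of prog & prog
| If of expr & prog & prog
| While of expr & prog.

Fixpoint eval (s : state) (x : expr) : nat :=
  match x with
  | Const m => m
  | Reg i => regs s i
  | Mem x => memory s (eval s x)
  | Add x y => eval s x + eval s y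
  | Sub x y => eval s x - eval s y
  end.

Fixpoint cost (x : expr) : nat :=
  match x with
  | Const _ | Reg _ => 1
  | Mem x => (cost x).+1
  | Add x y | Sub x y => (cost x + cost y).+1
  end.

Definition update (f : nat -> nat) (i v : nat) : nat -> nat :=
  fun j => if j == i then v else f j.

(* exec p s s' t: started in state s, the program p halts in state s' after   *)
(* t steps.  Tests succeed on nonzero values.                                 *)
Inductive exec : prog -> state -> state -> nat -> Prop :=
| ExecSkip s : exec Skip s s 1
| ExecAssign s i x :
    exec (Assign i x) s (State (update (regs s) i (eval s x)) (memory s))
      (cost x).+1
| ExecStore s x y :
    exec (Store x y) s
      (State (regs s) (update (memory s) (eval s x) (eval s y)))
      (cost x + cost y).+1
| ExecSeq p q s s1 s2 t1 t2 :
    exec p s s1 t1 -> exec q s1 s2 t2 -> exec (Seq p q) s s2 (t1 + t2)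
| ExecIfTrue x p q s s' t :
    eval s x != 0 -> exec p s s' t -> exec (If x p q) s s' (cost x + t).+1
| ExecIfFalse x p q s s' t :
    eval s x = 0 -> exec q s s' t -> exec (If x p q) s s' (cost x + t).+1
| ExecWhileTrue x p s s1 s2 t1 t2 :
    eval s x != 0 -> exec p s s1 t1 -> exec (While x p) s1 s2 t2 ->
    exec (While x p) s s2 (cost x + t1 + t2).+1
| ExecWhileFalse x p s :
    eval s x = 0 -> exec (While x p) s s (cost x).+1.

Lemma exec_deterministic p s s1 s2 t1 t2 :
  exec p s s1 t1 -> exec p s s2 t2 -> s1 = s2 /\ t1 = t2.
Proof.
have nz0 m : m != 0 -> m = 0 -> False by move=> /eqP.
move=> h; elim: h s2 t2 => {p s s1 t1} /=.
- by move=> s s2 t2 h; inversion h.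
- by move=> s i x s2 t2 h; inversion h.
- by move=> s x y s2 t2 h; inversion h.
- move=> p q s s1 s2 t1 t2 _ IH1 _ IH2 s3 t3 h.
  inversion h as [| | |? ? ? u1 ? ? ? hp hq| | | |]; subst.
  by case: (IH1 _ _ hp) => ? ?; subst; case: (IH2 _ _ hq) => ? ?; subst.
- move=> x p q s s' t hx _ IH s2 t2 h.
  inversion h as [| | | |? ? ? ? ? ? _ hp|? ? ? ? ? ? hx0| |]; subst.
    by case: (IH _ _ hp) => ? ?; subst.
  by case: (nz0 _ hx hx0).
- move=> x p q s s' t hx _ IH s2 t2 h.
  inversion h as [| | | |? ? ? ? ? ? hx1|? ? ? ? ? ? _ hq| |]; subst.
    by case: (nz0 _ hx1 hx).
  by case: (IH _ _ hq) => ? ?; subst.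
- move=> x p s s1 s2 t1 t2 hx _ IH1 _ IH2 s3 t3 h.
  inversion h as [| | | | | |? ? ? ? ? ? ? _ hp hw|? ? ? hx0]; subst.
    by case: (IH1 _ _ hp) => ? ?; subst; case: (IH2 _ _ hw) => ? ?; subst.
  by case: (nz0 _ hx hx0).
- move=> x p s hx s2 t2 h.
  inversion h as [| | | | | |? ? ? ? ? ? ? hx1|]; subst => //.
  by case: (nz0 _ hx1 hx).
Qed.

(* An instance is presented with n in register 0, k in register 1, the        *)
(* characteristic vector of S in the memory cells 0, ..., n - 1, and the      *)
(* adjacency matrix in row-major order in the n * n cells that follow; all    *)
(* other registers and cells contain 0.                                       *)
Definition input (n : nat) (e : rel 'I_n) (S : {set 'I_n}) (k : nat) : state :=
  State
    (fun r => match r with 0 => n | 1 => k | _ => 0 end)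
    (fun m => nat_of_bool
       ([exists i : 'I_n, (m == i) && (i \in S)] ||
        [exists i : 'I_n, exists j : 'I_n,
           (m == n + (n * i + j)) && e i j])).

(* Main.v *)
From mathcomp Require Import all_boot zify.
Require Import Defs.

Set Implicit Arguments.
Unset Strict Implicit.
Unset Printing Implicit Defensive.

(* T - F has no S-cycle for some F with |F| <= k if and only if V can be
   exhausted by a chain of sets in which each increment is a singleton or avoids
   S, the arcs from the increments back into the preceding sets numbering at most
   k.  All members X of such a chain are k-cuts: at most k arcs enter X.  Hence
   the optimum is a shortest path among k-cuts, and it suffices to bound their
   number.  A k-cut X of size i differs from the set of vertices of indegree
   less than i in O(sqrt k) vertices only: r misplaced vertices on one side span
   r(r-1)/2 arcs, which force as many arcs to enter X.  Moreover these vertices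
   have indegrees between i - k and i + k, and by the same count there are only
   O(k) such vertices as soon as some k-cut of size i exists.  So there are
   n * k^O(sqrt k) k-cuts, whatever the tournament; as the restriction of a k-cut
   to an initial segment of the vertices is again a k-cut, they are enumerated
   by inserting the vertices one by one. *)

(** * Counting cuts *)

Section Counting.
Variables (V : finType) (e : rel V).
Implicit Types A B X Y U : {set V}.

Definition narcs A B := \sum_(u in A) \sum_(v in B) e u v.

Lemma narcsE A B :
  narcs A B = #|[set a | [&& a.1 \in A, a.2 \in B & e a.1 a.2]]|.
Proof.
rewrite /narcs pair_big /= -sum1_card.
rewrite [RHS](eq_bigl (fun a => ((a.1 \in A) && (a.2 \in B)) && e a.1 a.2)).
  by rewrite [RHS]big_mkcondr /=; apply: eq_bigr => a _; case: (e _ _).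
by move=> a; rewrite inE andbA.
Qed.

Lemma sum_sub A B (f : V -> nat) :
  A \subset B -> \sum_(u in A) f u <= \sum_(u in B) f u.
Proof.
by move=> /setIidPr AB; rewrite [leqRHS](big_setID A) /= AB leq_addr.
Qed.

Lemma sum_const_set A c : \sum_(u in A) c = #|A| * c.
Proof. by rewrite big_const iter_addn_0 mulnC. Qed.

Hypothesis tourT : tournament e.

Lemma tour_pair u v : (e u v : nat) + e v u = (u != v).
Proof.
case: tourT => irr tour; case: eqVneq => [->|/tour]; first by rewrite irr.
by case: (e u v) (e v u) => [] [].
Qed.

Lemma tour_deg_notin u X : u \notin X ->
  \sum_(v in X) e v u + \sum_(v in X) e u v = #|X|.
Proof.
move=> uX; rewrite -big_split /= -sum1_card; apply: eq_bigr => v vX.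
by rewrite tour_pair; case: eqP vX uX => // -> ->.
Qed.

Lemma tour_deg_in u X : u \in X ->
  \sum_(v in X) e v u + \sum_(v in X) e u v + 1 = #|X|.
Proof.
case: tourT => irr _ uX; rewrite (cardsD1 u X) uX addnC; congr addn.
have {uX}XE (f : V -> nat) : \sum_(v in X) f v = f u + \sum_(v in X :\ u) f v.
  by rewrite (big_setD1 u).
by rewrite !XE irr !add0n tour_deg_notin // !inE eqxx.
Qed.

(** Adding in- and outdegree inside [U] counts every arc twice and misses, at each vertex, only the
    vertex itself. *)
Lemma narcs_self U : (narcs U U).*2 + #|U| = #|U| * #|U|.
Proof.
rewrite -addnn {2}/narcs exchange_big /= /narcs -big_split /=.
rewrite -[X in _ + X = _]muln1 -sum_const_set -big_split -sum_const_set /=.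
by apply: eq_bigr => u uU; rewrite [X in X + _]addnC tour_deg_in.
Qed.

Definition indeg A v := \sum_(u in A) e u v.

Lemma indegID A X v : X \subset A ->
  indeg A v = \sum_(u in X) e u v + \sum_(u in A :\: X) e u v.
Proof. by move=> XA; rewrite /indeg (big_setID X) /= (setIidPr XA). Qed.

(** A vertex u outside [X] receives |X| arcs from [X], less those it sends there, and further ones
    from [U]. The arcs sent into [X] belong to the cut. *)
Lemma cut_outer A X U : X \subset A -> U \subset A :\: X ->
  #|U| * #|X| + narcs U U <= \sum_(u in U) indeg A u + narcs (A :\: X) X.
Proof.
move=> XA UAX; apply: (@leq_trans (\sum_(u in U) indeg A u + narcs U X)).
  rewrite -sum_const_set {1}/narcs exchange_big -!big_split /=.
  apply: leq_sum => u uU.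
  have /setDP[uA uX] := subsetP UAX _ uU.
  rewrite -(tour_deg_notin uX) (indegID _ XA).
  by have := sum_sub (e^~ u) UAX; lia.
by rewrite leq_add2l /narcs sum_sub.
Qed.

(** A vertex u of [X] receives at most |X| - 1 arcs from [X], less those it sends within [U]. The
    arcs it receives from [A :\: X] belong to the cut. *)
Lemma cut_inner A X U : X \subset A -> U \subset X ->
  \sum_(u in U) indeg A u + narcs U U + #|U| <=
    #|U| * #|X| + narcs (A :\: X) X.
Proof.
move=> XA UX; rewrite {2}/narcs [X in _ <= _ + X]exchange_big /=.
apply: (@leq_trans (#|U| * #|X| + \sum_(v in U) \sum_(u in A :\: X) e u v)).
  rewrite -[X in _ + X <= _]muln1 -!sum_const_set /narcs -!big_split /=.
  apply: leq_sum => u uU.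
  have uX := subsetP UX _ uU.
  rewrite -(tour_deg_in uX) (indegID _ XA).
  by have := sum_sub (e u) UX; lia.
by rewrite leq_add2l sum_sub.
Qed.

(** Each such set consists of the values other than [None] of a map from ['I_m] to [W] with [None]
    adjoined; [None] pads enumerations shorter than [m]. *)
Lemma card_small_subsets (W : {set V}) m :
  #|[set B : {set V} | (B \subset W) && (#|B| <= m)]| <= #|W|.+1 ^ m.
Proof.
pose f (g : {ffun 'I_m -> option V}) := [set x | Some x \in codom g].
pose D := [set o : option V | if o is Some x then x \in W else true].
have cD : #|D| = #|W|.+1.
  have -> : D = None |: [set Some x | x in W].
    apply/setP => [[x|]]; rewrite !inE //=.
    by rewrite mem_imset // => ? ? [].
  rewrite cardsU1 card_imset; last by move=> ? ? [].
  by case: imsetP => // [[]].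
rewrite -cD -[m in X in _ <= X]card_ord -card_ffun_on.
apply: leq_trans (leq_imset_card f _); apply/subset_leq_card/subsetP => B.
rewrite inE => /andP[BW Bm].
have nthB i x : nth None (map Some (enum B)) i = Some x -> x \in B.
  move=> Bi; have ltiB : i < size (map Some (enum B)).
    by rewrite ltnNge; apply/negP => /(nth_default None); rewrite Bi.
  move: (mem_nth None ltiB); rewrite Bi mem_map ?mem_enum // => ? ? [] //.
apply/imsetP; exists [ffun i : 'I_m => nth None (map Some (enum B)) i].
  apply/ffun_onP => i; rewrite ffunE inE.
  by case E: (nth _ _ _) => [x|] //; apply: (subsetP BW); apply: nthB E.
apply/setP => x; rewrite inE; apply/idP/codomP => [xB|[i]]; last first.
  by rewrite ffunE => /esym/nthB.
have xi : index x (enum B) < #|B| by rewrite cardE index_mem mem_enum.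
exists (Ordinal (leq_trans xi Bm)); rewrite ffunE /= (nth_map x).
  by rewrite nth_index ?mem_enum.
by rewrite -cardE.
Qed.

Section Cuts.
Variables (k s : nat) (A : {set V}).
Hypothesis le_s : forall r, r * r <= 8 * k -> r <= s.

Definition cuts :=
  [set X : {set V} | (X \subset A) && (narcs (A :\: X) X <= k)].

Definition window i :=
  [set v in A | (i <= indeg A v + k) && (indeg A v < i + k)].

Definition below i := [set v in A | indeg A v < i].

Lemma sum_ge_const (U : {set V}) (f : V -> nat) c :
  (forall u, u \in U -> c <= f u) -> #|U| * c <= \sum_(u in U) f u.
Proof. by move=> cf; rewrite -sum_const_set leq_sum. Qed.

Lemma sum_le_const (U : {set V}) (f : V -> nat) c :
  (forall u, u \in U -> f u <= c) -> \sum_(u in U) f u <= #|U| * c.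
Proof. by move=> cf; rewrite -sum_const_set leq_sum. Qed.

(** Let [X] split the window into r1 inner and r2 outer vertices. As indegrees there are within k of
    |X|, [cut_inner] gives r1(r1 + 1) <= 2k(r1 + 1) and [cut_outer] gives r2(r2 - 1) <= 2k(r2 + 1),
    so r1 <= 2k and r2 <= 2k + 1. *)
Lemma card_window X : X \in cuts -> #|window #|X| | <= 4 * k + 1.
Proof.
rewrite inE => /andP[XA kX]; rewrite -(cardsID X).
have I1 : window #|X| :&: X \subset X by apply: subsetIr.
have I2 : window #|X| :\: X \subset A :\: X.
  by apply: setSD; apply/subsetP => v; rewrite inE => /andP[].
move: (cut_inner XA I1) (cut_outer XA I2) (narcs_self (window #|X| :&: X))
  (narcs_self (window #|X| :\: X)).
have L1 : #|window #|X| :&: X| * (#|X| - k)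
          <= \sum_(u in window #|X| :&: X) indeg A u.
  by apply: sum_ge_const => u; rewrite !inE => /andP[/and3P[_ ? _] _]; lia.
have L2 : \sum_(u in window #|X| :\: X) indeg A u
          <= #|window #|X| :\: X| * (#|X| + k).
  by apply: sum_le_const => u; rewrite !inE => /andP[_ /and3P[_ _ ?]]; lia.
move: L1 L2; set r1 := #|_ :&: _|; set r2 := #|_ :\: _|.
move=> L1 L2 H1 H2 N1 N2.
have M1 : r1 * #|X| <= r1 * (#|X| - k) + r1 * k.
  by rewrite -mulnDr leq_mul2l; lia.
have {H1 L1 N1 M1}r1k : r1 <= 2 * k.
  rewrite leqNgt; apply/negP => lt_r1.
  have : r1 * (2 * k).+1 <= r1 * r1 by rewrite leq_mul2l lt_r1 orbT.
  by move: H1 L1 N1 M1; lia.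
suff r2k : r2 <= 2 * k + 1 by lia.
rewrite leqNgt; apply/negP => lt_r2.
have : r2 * (2 * k + 2) <= r2 * r2 by rewrite leq_mul2l; lia.
move: H2 L2 N2; lia.
Qed.

(** Misplaced vertices have indegree at least |X| inside [X] and at most |X| - 1 outside, so the
    degree terms of [cut_inner] and [cut_outer] cancel, leaving r(r + 1) <= 2k on either side. *)
Lemma cut_near_below X : X \in cuts ->
  let D := (X :\: below #|X|) :|: (below #|X| :\: X) in
  (D \subset window #|X|) && (#|D| <= s).
Proof.
rewrite inE => /andP[XA kX] /=.
have inner U : U \subset X :\: below #|X| ->
    #|U| * #|U| + #|U| <= 2 * k /\
    \sum_(u in U) indeg A u + #|U| <= #|U| * #|X| + k.
  move=> UXb; have UX : U \subset X by apply: subset_trans UXb (subsetDl _ _).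
  have := sum_ge_const (U := U) (f := indeg A) (c := #|X|).
  have deg u : u \in U -> #|X| <= indeg A u.
    move=> /(subsetP UXb)/setDP[uX]; rewrite inE (subsetP XA _ uX) /=; lia.
  by move=> /(_ deg); move: (cut_inner XA UX) (narcs_self U); lia.
have outer U : U \subset below #|X| :\: X ->
    #|U| * #|U| + #|U| <= 2 * k /\ #|U| * #|X| <= \sum_(u in U) indeg A u + k.
  move=> UbX; have UX : U \subset A :\: X.
    apply: subset_trans UbX _.
    by apply/setSD/subsetP => u; rewrite inE => /andP[].
  have := sum_le_const (U := U) (f := fun u => (indeg A u).+1) (c := #|X|).
  have deg u : u \in U -> indeg A u < #|X|.
    by move=> /(subsetP UbX)/setDP[]; rewrite inE => /andP[].
  move=> /(_ deg); rewrite (eq_bigr _ (fun u _ => esym (addn1 (indeg A u)))).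
  rewrite big_split /= sum_const_set muln1.
  by move: (cut_outer XA UX) (narcs_self U); lia.
apply/andP; split.
  (* For a singleton [U], the second halves of [inner] and [outer] bound a single indegree. *)
  rewrite subUset; apply/andP; split; apply/subsetP => u ub.
    have [|_] := inner [set u]; first by rewrite sub1set.
    rewrite big_set1 cards1; case/setDP: ub => uX.
    by rewrite !inE (subsetP XA _ uX) /=; lia.
  have [|_] := outer [set u]; first by rewrite sub1set.
  rewrite big_set1 cards1; case/setDP: ub; rewrite !inE => /andP[-> uX] _ /=.
  lia.
(* The 8 in [le_s]: (r1 + r2)^2 <= 2(r1^2 + r2^2) <= 2(2k + 2k). *)
apply: le_s; have [r1 _] := inner _ (subxx _); have [r2 _] := outer _ (subxx _).
have := leq_card_setU (X :\: below #|X|) (below #|X| :\: X).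
move=> le_r; have := leq_mul le_r le_r.
have [+ _] := nat_Cauchy #|X :\: below #|X| | #|below #|X| :\: X|.
by rewrite -!mulnn; lia.
Qed.

(** A cut of size i is determined by its symmetric difference with [below i], one of the small
    subsets of [window i]. If there is any cut of size i, it bounds the window for all of them. *)
Lemma card_cuts : #|cuts| <= #|A|.+1 * (4 * k + 2) ^ s.
Proof.
pose C i := [set X in cuts | #|X| == i].
have Ci i : #|C i| <= (4 * k + 2) ^ s.
  have [->|[X0]] := set_0Vmem (C i); first by rewrite cards0.
  rewrite inE => /andP[/card_window + /eqP X0i]; rewrite X0i => Wi.
  pose f X := (X :\: below i) :|: (below i :\: X).
  have f_inj : injective f.
    move=> X Y /setP fXY; apply/setP => x.
    move: (fXY x); rewrite !in_setU !in_setD.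
    by case: (x \in X) (x \in Y) (x \in below i) => [] [] [].
  rewrite -(card_imset _ f_inj).
  apply: (@leq_trans (#|window i|.+1 ^ s)); last first.
    by case: (posnP s) => [->|s0]; rewrite ?expn0 // leq_exp2r; lia.
  apply: leq_trans (card_small_subsets _ _); apply/subset_leq_card/subsetP => B.
  case/imsetP => X /setIdP[kX /eqP Xi] ->.
  by have := cut_near_below kX; rewrite Xi inE.
apply: (@leq_trans (\sum_(i < #|A|.+1) #|C i|)); last first.
  rewrite -[#|A|.+1 in X in _ <= X]card_ord -sum_nat_const.
  by apply: leq_sum => i _; apply: Ci.
rewrite -sum1_card.
rewrite (partition_big (fun X : {set V} => inord #|X| : 'I_#|A|.+1) xpredT) //=.
apply: leq_sum => i _; rewrite -[leqRHS]sum1_card; apply/eq_leq/eq_bigl => X.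
rewrite !inE -andbA; case XA: (_ \subset _) => //=; congr andb.
by rewrite -val_eqE /= inordK // ltnS subset_leq_card.
Qed.

End Cuts.
End Counting.

(** * Chains of cuts *)

Section Layouts.
Variables (V : finType) (e : rel V) (S : {set V}).
Implicit Types X Y Z : {set V}.

(** Being a singleton or avoiding [S] is phrased as a condition on pairs of vertices, which a double
    sum can test. *)
Definition okstep X Y :=
  (X \subset Y) &&
  [forall u in Y :\: X, forall v in Y :\: X, (u \in S) ==> (u == v)].

Lemma okstepP X Y :
  reflect (X \subset Y /\ forall u v, u \in Y :\: X -> v \in Y :\: X ->
             u \in S -> u = v) (okstep X Y).
Proof.
apply: (iffP andP) => [[XY /forall_inP ok]|[XY ok]]; split=> //.
  move=> u v uYX vYX uS.
  by have /forall_inP/(_ v vYX)/implyP/(_ uS)/eqP := ok u uYX.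
apply/forall_inP => u uYX; apply/forall_inP => v vYX.
by apply/implyP => uS; apply/eqP/ok.
Qed.

Definition back X Y := narcs e (Y :\: X) X.

(** [P] constrains the members other than [set0]. Soundness holds for any [P]; completeness provides
    chains of k-cuts. *)
Inductive layout (P : pred {set V}) : {set V} -> nat -> Prop :=
| layout0 : layout P set0 0
| layoutS X Y c : layout P X c -> P Y -> okstep X Y ->
    layout P Y (c + back X Y).

Lemma path_pred_back (r : rel V) X x p :
  (forall u v, r u v -> v \in X -> u \in X) ->
  path r x p -> last x p \in X -> all (mem X) (x :: p).
Proof.
move=> rX; elim: p x => [|y p IH] x /=; first by rewrite andbT.
case/andP => xy yp /(IH _ yp) /= /andP[yX ->]; rewrite andbT.
by rewrite yX (rX _ _ xy).
Qed.

(** Rotated to start in [X], the cycle is a closed walk that can be followed backwards from its end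
    without leaving [X]. *)
Lemma cycle_pred (r : rel V) X c :
  (forall u v, r u v -> v \in X -> u \in X) ->
  cycle r c -> has (mem X) c -> all (mem X) c.
Proof.
move=> rX rc /hasP[x xc xX]; have [i c' rotc] := rot_to xc.
have : cycle r (x :: c') by rewrite -rotc rot_cycle.
move=> /(path_pred_back rX); rewrite last_rcons => /(_ xX).
rewrite /= all_rcons => /andP[_ /andP[_ /allP c'X]].
apply/allP => y; rewrite -(mem_rot i) rotc inE => /predU1P[->//|].
exact: c'X.
Qed.

Lemma delete_arcsE F u v : delete_arcs e F u v = e u v && ((u, v) \notin F).
Proof. by []. Qed.

(** [F] collects all back arcs of the chain. At the last increment, a surviving S-cycle that meets
    [X] cannot enter it from outside, so it lies in [X], against induction; otherwise it lies in an
    increment that meets [S], a single vertex without loop. *)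
Lemma layout_sound P Y c : irreflexive e -> layout P Y c ->
  exists F : {set V * V}, [/\ F \subset arcs e, #|F| <= c
    & forall p, S_cycle (delete_arcs e F) S p -> ~~ all (mem Y) p].
Proof.
move=> irr; elim=> [|X Z d _ [F [Fe Fd Fcyc]] _ /okstepP[XZ ok]].
  exists set0; split; rewrite ?sub0set ?cards0 // => p [[]].
  by case: p => // x p _ _ _; rewrite /= inE.
pose G := [set a | [&& a.1 \in Z :\: X, a.2 \in X & e a.1 a.2]].
exists (F :|: G); split.
- by rewrite subUset Fe; apply/subsetP => a; rewrite !inE => /and3P[].
- rewrite (leq_trans (leq_card_setU _ _)) // leq_add //.
  by rewrite /back narcsE.
move=> p [[p0 /andP[cp up]] Sp]; apply/negP => pZ.
have cyc (r : rel V) :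
    {in p &, forall u v, e u v && ((u, v) \notin F :|: G) -> r u v} ->
    cycle r p.
  by move=> sub; apply: (sub_in_cycle (P := mem p)) cp => //; apply/allP.
have [pX|pX] := boolP (has (mem X) p).
  have XG : cycle [rel u v | (u \in Z) && (v \in X) ==> (u \in X)] p.
    apply: cyc => u v up' vp /andP[euv].
    rewrite !inE /= euv andbT negb_or => /andP[_].
    by case: (u \in X) (u \in Z) (v \in X) => [] [] [].
  have {}XG : cycle [rel u v | (v \in X) ==> (u \in X)] p.
    apply: (sub_in_cycle (P := mem Z)) XG => // u v uZ _ /=.
    by move: uZ => /= ->.
  have pallX : all (mem X) p.
    by apply: cycle_pred XG pX => u v /= /implyP.
  have : S_cycle (delete_arcs e F) S p.
    split=> //; split=> //; rewrite /ucycle up andbT; apply: cyc => u v _ _.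
    by rewrite inE negb_or delete_arcsE => /and3P[-> ->].
  by move/Fcyc; rewrite pallX.
have pZX u : u \in p -> u \in Z :\: X.
  move=> uin; rewrite inE; have /= -> := allP pZ _ uin.
  by rewrite andbT; apply: contra pX => uX; apply/hasP; exists u.
case/hasP: Sp => s sp sS.
have ps v : v \in p -> v = s by move=> vp; rewrite -(ok s v) // pZX.
have := cyc e (fun u v _ _ uv => proj1 (andP uv)).
case: p p0 ps {cp up pZ pX pZX cyc sp} => // x [|y p] _ ps.
  by rewrite /= irr.
by rewrite /= (ps x) ?inE ?eqxx // (ps y) ?irr // !inE eqxx orbT.
Qed.

(** The chain grows by source strong components of T - F. All arcs entering one of its members lie
    in [F], which makes the member a k-cut. *)
Lemma layout_complete k : subset_FAST e S k ->
  exists2 c, layout (fun X => narcs e (~: X) X <= k) setT c & c <= k.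
Proof.
case=> F [Fe Fk Fcyc]; set P := fun X => _; pose r := delete_arcs e F.
pose closed X := forall u v, u \notin X -> v \in X -> ~~ r u v.
pose inside X := F :&: setX X X.
have arcF X u v : closed X -> u \notin X -> v \in X -> e u v -> (u, v) \in F.
  move=> cX uX vX euv; move: (cX u v uX vX).
  by rewrite /r delete_arcsE euv negbK.
have PX X : closed X -> P X.
  move=> cX; apply: leq_trans Fk; rewrite narcsE; apply/subset_leq_card/subsetP.
  by case=> u v; rewrite !inE => /and3P[/= uX vX euv]; apply: arcF cX _ _ _.
(* The cost so far is charged to the arcs of [F] inside [X]. The next increment pays for arcs of [F]
   from outside into [X], which become inside arcs only then. *)
suff main m X c : #|~: X| <= m -> closed X -> layout P X c ->
    c <= #|inside X| -> exists2 c, layout P setT c & c <= k.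
  apply: (main _ _ _ (leqnn _) _ (layout0 P) (leq0n _)).
  by move=> u v _; rewrite inE.
elim: m X c => [|m IH] X c.
  rewrite leqn0 cards_eq0 => /eqP X0 _ lX cX; exists c.
    by rewrite -(setCK X) X0 setC0 in lX.
  apply: leq_trans (leq_trans _ Fk); first exact: cX.
  by apply/subset_leq_card/subsetIl.
have [X0|[u0 u0X]] := set_0Vmem (~: X).
  by rewrite X0 cards0 => _; apply: IH; rewrite X0 cards0.
move=> Xm clX lX cX.
(* [B u] holds the vertices outside [X] that reach u. A smallest one is strongly connected: for v in
   it, [B v] is contained in it, hence equal to it. *)
pose B u := [set w in ~: X | connect r w u].
case: (arg_minnP (fun u => #|B u|) u0X) => u uX umin.
have {}uX : u \in ~: X := uX.
have BB v : v \in B u -> B v = B u.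
  rewrite inE => /andP[vX vu]; apply/eqP; rewrite eqEcard umin // andbT.
  apply/subsetP => w; rewrite !inE => /andP[-> wv] /=.
  by apply: connect_trans wv vu.
have uB : u \in B u by rewrite inE uX connect0.
have BX v : v \in B u -> v \notin X by rewrite !inE => /andP[].
have YX : (X :|: B u) :\: X = B u.
  apply/setP => v; rewrite !in_setD in_setU; move: (BX v).
  by case: (v \in X) (v \in B u) => [] [] //= /(_ isT).
have clY : closed (X :|: B u).
  move=> w v; rewrite !in_setU negb_or => /andP[wX wB] /orP[/(clX _ _ wX)//|vB].
  apply: contra wB => rwv; rewrite -(BB v vB) !inE wX /=.
  exact: connect1.
have ok : okstep X (X :|: B u).
  apply/okstepP; split; first exact: subsetUl.
  rewrite YX => s v sB vB sS; apply/eqP/negPn/negP => sv; apply: Fcyc.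
  have sv' : connect r s v by move: sB; rewrite -(BB v vB) inE => /andP[].
  have vs' : connect r v s by move: vB; rewrite -(BB s sB) inE => /andP[].
  (* An arc from s to some w on the way to v closes a path from w through v back to s; [shortenP]
     makes its vertices distinct. *)
  have [w rsw wv] : exists2 w, r s w & connect r w v.
    case/connectP: sv' => [[|w p]] /=.
      by move=> _ E; rewrite E eqxx in sv.
    by case/andP=> rsw wp E; exists w => //; apply/connectP; exists p.
  have /connectP[p wp ps] := connect_trans wv vs'.
  move: ps; case/shortenP: wp => q wq uq _ ps.
  exists (w :: q); split; first split=> //.
    by rewrite /ucycle uq andbT /= rcons_path wq /= -ps.
  by apply/hasP; exists s => //; rewrite ps mem_last.
apply: (IH (X :|: B u) (c + back X (X :|: B u))) => //.
- rewrite -ltnS; apply: leq_trans Xm; apply: proper_card; apply/properP; split.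
    by apply/subsetP => v; rewrite !inE negb_or => /andP[].
  by exists u => //; rewrite in_setC negbK in_setU uB orbT.
- by apply: layoutS => //; apply: PX.
pose G := [set a | [&& a.1 \in B u, a.2 \in X & e a.1 a.2]].
apply: (@leq_trans (#|inside X| + #|G|)).
  by rewrite leq_add // /back YX narcsE.
rewrite -cardsUI (_ : _ :&: _ = set0) ?cards0 ?addn0; last first.
  apply/setP => [[x y]].
  rewrite !in_setI in_setX [_ \in [set _ | _]]inE in_set0 /=.
  by apply/negP => /andP[/and3P[_ xX _] /and3P[/BX]]; rewrite xX.
apply/subset_leq_card/subsetP => [[x y]].
rewrite in_setU !in_setI !in_setX [_ \in [set _ | _]]inE !in_setU /=.
case/orP=> [/and3P[-> -> ->] //|/and3P[xB yX exy]].
by rewrite (arcF X) ?BX // xB yX orbT.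
Qed.

(** * Shortest chains by dynamic programming *)

Section Tables.
Variable k : nat.

Definition relax Y b (x : {set V} * nat) :=
  if okstep x.1 Y && (x.2 + back x.1 Y < b) then x.2 + back x.1 Y else b.

(** The initial k + 1 serves as infinity: all costs above k are recorded as k + 1. *)
Definition best xs Y := foldl (relax Y) k.+1 xs.

Lemma best_rcons xs x Y : best (rcons xs x) Y = relax Y (best xs Y) x.
Proof. by rewrite /best foldl_rcons. Qed.

Lemma best_le xs Y X d :
  (X, d) \in xs -> okstep X Y -> best xs Y <= d + back X Y.
Proof.
move=> + ok; elim/last_ind: xs => // xs x IH; rewrite mem_rcons inE best_rcons.
case/predU1P=> [<-|/IH]; rewrite /relax; last first.
  by case: ifP => // /andP[_ /ltnW] /leq_trans h /h.
by rewrite /= ok /=; case: ltnP.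
Qed.

Lemma best_attained xs Y : best xs Y <= k ->
  exists x, [/\ x \in xs, okstep x.1 Y & best xs Y = x.2 + back x.1 Y].
Proof.
elim/last_ind: xs => [|xs x IH]; first by rewrite /best /= ltnn.
rewrite best_rcons /relax; case: ifP => [/andP[ok _] _|_].
  by exists x; rewrite mem_rcons mem_head.
by case/IH=> y [yxs ? ?]; exists y; split=> //; rewrite mem_rcons inE yxs orbT.
Qed.

(** The order of the records refines inclusion. All possible predecessors of a tabulated set thus
    precede it, and its cost is final when computed. *)
Inductive table : seq ({set V} * nat) -> Prop :=
| table1 : table [:: (set0, 0)]
| tableS xs Y : table xs ->
    ~~ has (fun x : {set V} * nat => Y \subset x.1) xs ->
    table (rcons xs (Y, best xs Y)).

(** An entry of at most k differs from the initial k + 1, so it comes from an earlier record, whose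
    cost is no larger. *)
Lemma table_layout xs Y d : table xs -> (Y, d) \in xs -> d <= k ->
  layout predT Y d.
Proof.
move=> txs; elim: txs Y d => [|{}xs Z _ IH _] Y d.
  by rewrite inE => /eqP[-> ->] _; apply: layout0.
rewrite mem_rcons inE => /predU1P[[-> ->]|/IH//].
move=> ck; have [[X c] [Xxs ok bE]] := best_attained ck.
rewrite bE in ck *.
by apply: layoutS => //; apply: IH Xxs _; apply: leq_trans ck; apply: leq_addr.
Qed.

Lemma table_set0 xs d : table xs -> (set0, d) \in xs -> d = 0.
Proof.
elim=> [|{}xs Z t IH Zxs]; first by rewrite inE => /eqP[].
rewrite mem_rcons inE => /predU1P[[Z0 _]|//].
case/negP: Zxs; rewrite -Z0.
by case: t => [|? ? ? ?]; rewrite ?has_rcons /= sub0set.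
Qed.

(** The triangle inequality of shortest paths. The order of the table excludes that [X] is appended
    after [Y]. *)
Lemma table_min xs X Y c d : table xs -> (X, c) \in xs -> (Y, d) \in xs ->
  okstep X Y -> d <= c + back X Y.
Proof.
move=> txs + + ok; have /okstepP[XY _] := ok.
elim: txs => [|{}xs Z _ IH Zxs].
  by rewrite !inE => /eqP[_ ->] /eqP[_ ->].
rewrite !mem_rcons !inE => /predU1P[[XZ ->]|Xxs] /predU1P[[YZ ->]|Yxs].
- exact: leq_addr.
- by case/hasP: Zxs; exists (Y, d) => //=; rewrite -XZ.
- by rewrite -YZ; apply: best_le.
- exact: IH.
Qed.

(** Induction along the chain: every member has a record, to which [table_min] applies. *)
Lemma table_optimal (P : pred {set V}) xs Y c d : table xs ->
  (forall X, P X -> X \in unzip1 xs) ->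
  layout P Y c -> (Y, d) \in xs -> d <= c.
Proof.
move=> txs domP lY; elim: lY d => [|X Z b lX IH PZ ok] d.
  by move/(table_set0 txs) => ->.
have [X0 X0'] : exists b', (X, b') \in xs.
  case: lX => [|? ? ? ? /domP/mapP[[? b'] ? /= ->] _]; last by exists b'.
  exists 0; elim: {domP} txs => [|? ? ? IHt _].
    by rewrite inE.
  by rewrite mem_rcons inE IHt orbT.
move=> Zxs; apply: leq_trans (table_min txs X0' Zxs ok) _.
by rewrite leq_add2r IH.
Qed.

(** For one direction only chains of k-cuts matter, and these are tabulated; for the other, any
    chain behind the entry of [setT] is sound. *)
Lemma table_correct xs d : irreflexive e -> table xs ->
  (forall X, narcs e (~: X) X <= k -> X \in unzip1 xs) ->
  (setT, d) \in xs -> subset_FAST e S k <-> d <= k.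
Proof.
move=> irr txs dom dxs; split=> [/layout_complete[c lc ck]|dk].
  by apply: leq_trans ck; apply: table_optimal lc dxs.
have [F [Fe Fd Fcyc]] := layout_sound irr (table_layout txs dxs dk).
exists F; split=> //; first exact: leq_trans Fd dk.
by case=> p /Fcyc /allPn[x _]; rewrite /= inE.
Qed.

End Tables.
End Layouts.

(** * Enumeration of cuts *)

Section Domains.
Variables (n : nat) (e : rel 'I_n) (k : nat).
Implicit Types X Y Z : {set 'I_n}.

Definition upto j := [set u : 'I_n | u <= j].

Definition under j := [set u : 'I_n | u < j].

Definition insert j X := [set u : 'I_n | (u \in X) || (u == j :> nat)].

Definition cutok j Y := narcs e (upto j :\: Y) Y <= k.

Definition extend j (Xs : seq {set 'I_n}) :=
  [seq Y <- [seq insert j X | X <- Xs] | cutok j Y].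

(** A set is tested only when its largest vertex is inserted, against the vertices up to that one.
    The list may therefore contain sets that are not k-cuts of the whole tournament. *)
Fixpoint domain j : seq {set 'I_n} :=
  if j is i.+1 then domain i ++ extend i (domain i) else [:: set0].

Lemma extendP j Xs Y :
  reflect (exists X, [/\ X \in Xs, Y = insert j X & cutok j Y])
    (Y \in extend j Xs).
Proof.
rewrite mem_filter.
apply: (iffP andP) => [[kY /mapP[X XXs YX]]|[X [XXs -> kX]]].
  by exists X.
by split=> //; apply: map_f.
Qed.

Lemma domain_under j X : X \in domain j -> X \subset under j.
Proof.
elim: j X => [|j IH] X; first by rewrite inE => /eqP ->; rewrite sub0set.
rewrite mem_cat => /orP[/IH|/extendP[Z [/IH Zj -> _]]].
  by move=> /subset_trans; apply; apply/subsetP => u; rewrite !inE; lia.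
apply/subsetP => u; rewrite !inE => /orP[/(subsetP Zj)|/eqP->//].
by rewrite inE; lia.
Qed.

Lemma domain_complete j Z : narcs e (~: Z) Z <= k -> j <= n ->
  Z :&: under j \in domain j.
Proof.
move=> kZ; elim: j => [|j IH] jn.
  rewrite (_ : _ :&: _ = set0) ?inE //.
  by apply/setP => u; rewrite !inE andbF.
have /IH Zj : j <= n by lia.
rewrite mem_cat; have [jZ|jZ] := boolP (Ordinal jn \in Z).
  apply/orP; right; apply/extendP; exists (Z :&: under j).
  have ZE : Z :&: under j.+1 = insert j (Z :&: under j).
    apply/setP => u; rewrite !inE ltnS leq_eqVlt andb_orr orbC; congr orb.
    case: eqP => [uj|_]; last by rewrite andbF.
    by rewrite andbT -[RHS]jZ; congr in_mem; apply/val_inj.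
  (* An arc into the restriction of [Z] from the other vertices up to j starts outside [Z], so it
     also enters [Z]. *)
  split=> //; apply: leq_trans kZ; rewrite !narcsE.
  apply/subset_leq_card/subsetP.
  case=> u v; rewrite !inE /= => /and3P[/andP[uZ uj] /andP[-> _] ->].
  by rewrite uj andbT in uZ; rewrite uZ.
apply/orP; left; suff -> : Z :&: under j.+1 = Z :&: under j by [].
apply/setP => u; rewrite !inE ltnS leq_eqVlt andb_orr.
case: eqP => [uj|_]; last by rewrite andbF.
by rewrite (_ : u = Ordinal jn) ?(negbTE jZ) //; apply: val_inj.
Qed.

(** The order demanded by [table]. Since no set may contain a later one, repetitions are excluded
    too. *)
Definition sorted_subsets :=
  pairwise (fun X Y : {set 'I_n} => ~~ (Y \subset X)).

Lemma insert_subset j X Z : X \subset under j ->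
  insert j X \subset insert j Z -> X \subset Z.
Proof.
move=> Xj /subsetP XZ; apply/subsetP => u uX; have := XZ u.
rewrite !inE uX => /(_ isT) /orP[//|/eqP uj].
by have := subsetP Xj _ uX; rewrite inE uj ltnn.
Qed.

Lemma insert_notin_under j X Z :
  j < n -> Z \subset under j -> ~~ (insert j X \subset Z).
Proof.
move=> jn Zj; apply/subsetPn; exists (Ordinal jn).
  by rewrite inE /= eqxx orbT.
by apply/negP => /(subsetP Zj); rewrite inE /= ltnn.
Qed.

Lemma sorted_extend j Xs : (forall X, X \in Xs -> X \subset under j) ->
  sorted_subsets Xs -> sorted_subsets (extend j Xs).
Proof.
move=> Xsj sXs; apply: subseq_pairwise (filter_subseq _ _) _.
rewrite pairwise_map.
apply: (sub_in_pairwise (P := mem Xs)) sXs; last exact/allP.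
by move=> X Y _ /= /Xsj Yj; apply: contra; apply: insert_subset Yj.
Qed.

(** New sets contain j and old ones do not; among new ones, inserting j creates no inclusions. *)
Lemma domain_sorted j : j <= n -> sorted_subsets (domain j).
Proof.
elim: j => // j IH jn; rewrite /sorted_subsets /= pairwise_cat.
have sj : sorted_subsets (domain j) by apply: IH; lia.
apply/and3P; split=> //; last exact: sorted_extend (@domain_under j) sj.
apply/allrelP => X Y /domain_under Xj /extendP[Z [_ -> _]].
exact: insert_notin_under.
Qed.

Lemma setT_domain : setT \in domain n.
Proof.
have := @domain_complete n setT; rewrite setTI (_ : under n = setT).
  by apply=> //; rewrite setCT /narcs big_set0.
by apply/setP => u; rewrite !inE ltn_ord.
Qed.

(** No set can follow [setT] in this order. The program thus finds its answer in the last record. *)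
Lemma last_domain : last set0 (domain n) = setT.
Proof.
have := domain_sorted (leqnn n); have := setT_domain.
case/lastP: (domain n) => // Xs X; rewrite last_rcons /sorted_subsets.
rewrite mem_rcons inE pairwise_rcons => /predU1P[//|TXs] /andP[/allP/(_ _ TXs)].
by rewrite subsetT.
Qed.

Lemma sorted_subsets_uniq Xs : sorted_subsets Xs -> uniq Xs.
Proof. by apply: pairwise_uniq => X; rewrite subxx. Qed.

(** The side condition of [tableS] for the next record: older sets lack j, and those made earlier in
    this stage stem from earlier sets. *)
Lemma sorted_subsets_insert j i : j < n -> i < size (domain j) ->
  let Xs := domain j in
  forall Z, Z \in Xs ++ extend j (take i Xs) ->
    ~~ (insert j (nth set0 Xs i) \subset Z).
Proof.
move=> jn iXs Xs Z; rewrite mem_cat => /orP[/domain_under|].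
  exact: insert_notin_under.
case/extendP=> X [XXs -> _].
have Xi : nth set0 Xs i \in Xs by apply: mem_nth.
apply/negP => /(insert_subset (domain_under Xi)); apply/negP.
have := domain_sorted (ltnW jn); rewrite /sorted_subsets -/Xs.
rewrite -(cat_take_drop i Xs) pairwise_cat => /and3P[/allrelP + _ _].
by apply=> //; rewrite cat_take_drop (drop_nth set0) ?mem_head.
Qed.

Lemma size_domain_mono i j : i <= j -> size (domain i) <= size (domain j).
Proof.
move/subnKC <-; elim: (j - i) => [|m IH]; first by rewrite addn0.
by rewrite addnS /= size_cat (leq_trans IH) ?leq_addr.
Qed.

Lemma extend_take j i : j < n ->
  size (domain j ++ extend j (take i (domain j))) <= size (domain n).
Proof.
move=> jn; apply: leq_trans (size_domain_mono jn).
rewrite /= !size_cat leq_add2l.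
rewrite -[in leqRHS](cat_take_drop i (domain j)) /extend map_cat filter_cat.
by rewrite size_cat leq_addr.
Qed.

(** The sets added at stage j are distinct k-cuts of the subtournament on [upto j], so [card_cuts]
    bounds each of the n stages. *)
Lemma size_domain s : tournament e -> (forall r, r * r <= 8 * k -> r <= s) ->
  size (domain n) <= n.+1 * n.+1 * (4 * k + 2) ^ s.
Proof.
move=> te le_s; set M := _ ^ s; have M0 : 0 < M by rewrite expn_gt0; lia.
suff H j : j <= n -> size (domain j) <= 1 + j * (n.+1 * M).
  by apply: leq_trans (H n (leqnn n)) _; nia.
elim: j => // j IH jn; rewrite /= size_cat.
suff : size (extend j (domain j)) <= n.+1 * M by have := IH (ltnW jn); lia.
have uE : uniq (extend j (domain j)).
  apply/sorted_subsets_uniq/sorted_extend; first exact: domain_under.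
  exact: domain_sorted (ltnW jn).
rewrite -(card_uniqP uE); apply: (@leq_trans #|cuts e k (upto j)|).
  apply/subset_leq_card/subsetP => Y /extendP[X [/domain_under Xj YX kY]].
  rewrite inE; apply/andP; split=> //; rewrite YX.
  apply/subsetP => u; rewrite !inE.
  by case/orP=> [/(subsetP Xj)|/eqP ->//]; rewrite inE; lia.
apply: leq_trans (card_cuts te _ le_s) _; rewrite leq_mul2r ltnS.
by rewrite -[leqRHS]card_ord max_card orbT.
Qed.

End Domains.

(** * Programs *)

(** A Hoare triple for total correctness with a time bound. *)
Definition runs p s B (Q : state -> Prop) :=
  exists s' t, [/\ exec p s s' t, t <= B & Q s'].

Lemma runs_weaken p s B B' (P Q : state -> Prop) :
  runs p s B P -> B <= B' -> (forall s', P s' -> Q s') -> runs p s B' Q.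
Proof.
case=> s' [t [ex tB Ps']] BB' PQ; exists s', t; split=> //; last exact: PQ.
exact: leq_trans BB'.
Qed.

Lemma runs_le p s B B' (Q : state -> Prop) :
  runs p s B Q -> B <= B' -> runs p s B' Q.
Proof. by move=> h BB'; apply: runs_weaken h BB' _. Qed.

Lemma runs_imp p s B (P Q : state -> Prop) :
  runs p s B P -> (forall s', P s' -> Q s') -> runs p s B Q.
Proof. by move=> h PQ; apply: runs_weaken h (leqnn B) PQ. Qed.

Lemma runs_skip s (Q : state -> Prop) : Q s -> runs Skip s 1 Q.
Proof. by exists s, 1; split=> //; constructor. Qed.

Lemma runs_assign s i x (Q : state -> Prop) :
  Q (State (update (regs s) i (eval s x)) (memory s)) ->
  runs (Assign i x) s (cost x).+1 Q.
Proof. by eexists _, _; split; [constructor| |]. Qed.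

Lemma runs_store s x y (Q : state -> Prop) :
  Q (State (regs s) (update (memory s) (eval s x) (eval s y))) ->
  runs (Store x y) s (cost x + cost y).+1 Q.
Proof. by eexists _, _; split; [constructor| |]. Qed.

Lemma runs_seq p q s B1 B2 (Q : state -> Prop) :
  runs p s B1 (fun s1 => runs q s1 B2 Q) -> runs (Seq p q) s (B1 + B2) Q.
Proof.
case=> s1 [t1 [ex1 t1B [s2 [t2 [ex2 t2B Qs2]]]]].
by exists s2, (t1 + t2); split=> //; [apply: ExecSeq ex1 ex2|apply: leq_add].
Qed.

Lemma runs_if x p q s B (Q : state -> Prop) :
  (eval s x != 0 -> runs p s B Q) -> (eval s x = 0 -> runs q s B Q) ->
  runs (If x p q) s (cost x + B).+1 Q.
Proof.
have [x0 _ /(_ x0)|x0 /(_ isT)] := eqVneq (eval s x) 0.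
  case=> s' [t [ex tB Qs']] ; exists s', (cost x + t).+1.
  by split=> //; [apply: ExecIfFalse|rewrite ltnS leq_add2l].
case=> s' [t [ex tB Qs']] _; exists s', (cost x + t).+1.
by split=> //; [apply: ExecIfTrue|rewrite ltnS leq_add2l].
Qed.

(** The invariant is indexed by the number of completed rounds, of which there are exactly [m]. *)
Lemma runs_while x p s B m (I : nat -> state -> Prop) :
  (forall i s, i < m -> I i s -> eval s x != 0 /\ runs p s B (I i.+1)) ->
  (forall s, I m s -> eval s x = 0) -> I 0 s ->
  runs (While x p) s (m * (cost x + B).+1 + (cost x).+1) (I m).
Proof.
move=> step stop I0; suff run d i s' : i + d = m -> I i s' ->
    runs (While x p) s' (d * (cost x + B).+1 + (cost x).+1) (I m).
  exact: run I0.
elim: d i s' => [|d IH] i s' idm Ii.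
  move: Ii; rewrite -[i]addn0 idm => Im; exists s', (cost x).+1.
  by split=> //; apply/ExecWhileFalse/stop.
have [|x0 [s1 [t1 [ex1 t1B I1]]]] := step i s' _ Ii; first by lia.
have [|s2 [t2 [ex2 t2B I2]]] := IH i.+1 s1 _ I1; first by lia.
exists s2, (cost x + t1 + t2).+1; split=> //; first exact: ExecWhileTrue ex2.
lia.
Qed.

(* Register 0 contains n, 2 and 3 the indices u and v of the summation, 4 the
   address of the matrix entry (u, v), and 5 the accumulator. *)
Definition double_sum (x : expr) :=
  Seq (Assign 2 (Const 0)) (Seq (Assign 4 (Reg 0))
    (While (Sub (Reg 0) (Reg 2))
      (Seq (Assign 3 (Const 0)) (Seq
        (While (Sub (Reg 0) (Reg 3))
          (Seq (Assign 5 (Add (Reg 5) x))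
          (Seq (Assign 4 (Add (Reg 4) (Const 1)))
               (Assign 3 (Add (Reg 3) (Const 1))))))
        (Assign 2 (Add (Reg 2) (Const 1))))))).

(** Registers 2 to 5 are the scratch space of [double_sum]. *)
Definition same s0 s :=
  (forall r, (r < 2) || (5 < r) -> regs s r = regs s0 r) /\
  memory s = memory s0.

Lemma sum_below_S n (f : 'I_n -> nat) i (ltin : i < n) :
  \sum_(u < n | u < i.+1) f u = \sum_(u < n | u < i) f u + f (Ordinal ltin).
Proof.
rewrite (bigD1 (Ordinal ltin)) //= addnC; congr addn; apply: eq_bigl => u.
by rewrite -val_eqE /=; lia.
Qed.

Lemma sum_below0 n (f : 'I_n -> nat) : \sum_(u < n | u < 0) f u = 0.
Proof. by rewrite big_pred0. Qed.

Lemma sum_below_all n (f : 'I_n -> nat) :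
  \sum_(u < n | u < n) f u = \sum_(u < n) f u.
Proof. by apply: eq_bigl => u; rewrite ltn_ord. Qed.

(** Register 4 advances with v and is never reset between rows, so it traverses the row-major matrix
    without multiplication and ends at the first address behind it. An inner round costs
    [cost x + 15]. *)
Lemma runs_double_sum n x s0 (g : 'I_n -> 'I_n -> nat) : regs s0 0 = n ->
  (forall s (u v : 'I_n), same s0 s -> regs s 2 = u -> regs s 3 = v ->
     regs s 4 = n + (n * u + v) -> eval s x = g u v) ->
  runs (double_sum x) s0 ((cost x + 15) * n.+1 ^ 2)
    (fun s => [/\ same s0 s, regs s 4 = n + n * n
      & regs s 5 = regs s0 5 + \sum_(u < n) \sum_(v < n) g u v]).
Proof.
move=> s0n gx.
pose I i s := [/\ same s0 s, regs s 2 = i, regs s 4 = n + n * i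
  & regs s 5 = regs s0 5 + \sum_(u < n | u < i) \sum_(v < n) g u v].
apply: (@runs_weaken _ _ _ _ (I n)); last first.
  by move=> s [? _ ? ->]; rewrite sum_below_all.
all: cycle 1.
rewrite /double_sum; do 2![apply: runs_seq; apply: runs_assign].
apply: runs_while => [i s ltin||].
- case=> sames s2 s4 s5; have sn : regs s 0 = n by rewrite (sames.1 0).
  split; first by rewrite /= sn s2; lia.
  pose J l s' := [/\ same s0 s', regs s' 2 = i /\ regs s' 3 = l,
    regs s' 4 = n + (n * i + l)
    & regs s' 5 = regs s 5 + \sum_(v < n | v < l) g (Ordinal ltin) v].
  apply: runs_seq; apply: runs_assign; apply: runs_seq.
  apply: (@runs_weaken _ _ _ _ (J n)).
  + apply: runs_while => [l s' ltln||].
    * case=> sames' [s2' s3'] s4' s5'.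
      have sn' : regs s' 0 = n by rewrite (sames'.1 0).
      split; first by rewrite /= sn' s3'; lia.
      do 2![apply: runs_seq; apply: runs_assign]; apply: runs_assign.
      split; rewrite /= /update /=.
      - split; last exact: sames'.2.
        move=> r hr; rewrite -(sames'.1 r hr).
        by move: r hr => [|[|[|[|[|[|r]]]]]].
      - by rewrite s3' addn1.
      - by rewrite s4'; lia.
      - rewrite s5' (sum_below_S _ ltln).
        by rewrite (gx _ (Ordinal ltin) (Ordinal ltln)) //; lia.
    * move=> s' [sames' [_ s3'] _ _].
      by rewrite /= (sames'.1 0) // s0n s3'; lia.
    * split; rewrite /= /update /= ?sum_below0 ?addn0 //.
      split; last exact: sames.2.
      move=> r hr; rewrite -(sames.1 r hr).
      by move: r hr => [|[|[|[|[|[|r]]]]]].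
  + exact: leqnn.
  move=> s' [sames' [s2' s3'] s4' s5']; apply: runs_assign.
  split; rewrite /= /update /=.
  + split; last exact: sames'.2.
    by move=> r hr; rewrite -(sames'.1 r hr); move: r hr => [|[|[|[|[|[|r]]]]]].
  + by rewrite s2' addn1.
  + by rewrite s4' mulnS; lia.
  + by rewrite s5' s5 sum_below_all (sum_below_S _ ltin) addnA.
- by move=> s [sames s2 _ _]; rewrite /= (sames.1 0) // s0n s2; lia.
- split; rewrite /= /update /= ?sum_below0 ?addn0 ?muln0 ?addn0 //.
  split=> // r hr; move: r hr => [|[|[|[|[|[|r]]]]]] //.
rewrite /=; nia.
Qed.

(** * The program and its correctness *)

(* Registers: 0 holds n, 1 holds k, 6 the address of the first record and 7 the
   first free address, 8 the vertex j being inserted, 9 the end of the records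
   present at the beginning of stage j, 10 the record being extended, 11 the
   record from which the new one is reached, 12 the least cost so far.  A record
   consists of the n bits of a set followed by its cost. *)
Definition bit a i := Mem (Add (Reg a) (Reg i)).

(* The conjunction of r bits is their sum minus r - 1, by truncation. *)
Definition viol_expr :=
  Add (Sub (bit 11 2) (bit 7 2))
    (Sub
      (Add (Add (Sub (bit 7 2) (bit 11 2)) (Sub (bit 7 3) (bit 11 3)))
        (Add (Mem (Reg 2))
          (Sub (Const 1) (Sub (Const 1)
            (Add (Sub (Reg 2) (Reg 3)) (Sub (Reg 3) (Reg 2)))))))
      (Const 3)).

Definition back_expr :=
  Sub (Add (Sub (bit 7 2) (bit 11 2)) (Add (bit 11 3) (Mem (Reg 4))))
    (Const 2).

Definition cut_expr :=
  Sub (Add (Sub (Const 1) (Add (bit 7 2) (Sub (Reg 2) (Reg 8))))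
             (Add (bit 7 3) (Mem (Reg 4))))
    (Const 2).

Definition next a := Assign a (Add (Reg a) (Add (Reg 0) (Const 1))).

(** The bit of u is increased by 1 - |u - j|, the indicator of u = j. It remains a bit because sets
    copied at stage j lack j. *)
Definition copy_prog :=
  Seq (Assign 2 (Const 0))
    (While (Sub (Reg 0) (Reg 2))
      (Seq (Store (Add (Reg 7) (Reg 2))
             (Add (bit 10 2) (Sub (Const 1)
               (Add (Sub (Reg 2) (Reg 8)) (Sub (Reg 8) (Reg 2))))))
           (Assign 2 (Add (Reg 2) (Const 1))))).

(** As register 0 holds n, [bit 11 0] is the cell behind the n bits, which holds the cost; the
    second sum adds the back arcs to it. *)
Definition relax_prog :=
  Seq (Assign 5 (Const 0)) (Seq (double_sum viol_expr) (Seq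
    (If (Reg 5) Skip
      (Seq (Assign 5 (bit 11 0)) (Seq (double_sum back_expr)
        (If (Sub (Reg 12) (Reg 5)) (Assign 12 (Reg 5)) Skip))))
    (next 11))).

Definition best_prog :=
  Seq (Assign 12 (Add (Reg 1) (Const 1))) (Seq (Assign 11 (Reg 6))
    (While (Sub (Reg 7) (Reg 11)) relax_prog)).

(** The candidate is written into free memory and becomes a record only if [next 7] is executed; a
    rejected one is overwritten. *)
Definition extend_prog :=
  Seq copy_prog (Seq (Assign 5 (Const 0)) (Seq (double_sum cut_expr) (Seq
    (If (Sub (Reg 5) (Reg 1)) Skip
      (Seq best_prog (Seq (Store (Add (Reg 7) (Reg 0)) (Reg 12)) (next 7))))
    (next 10)))).

Definition stage_prog :=
  Seq (Assign 9 (Reg 7)) (Seq (Assign 10 (Reg 6)) (Seq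
    (While (Sub (Reg 9) (Reg 10)) extend_prog)
    (Assign 8 (Add (Reg 8) (Const 1))))).

(** The sum of zeros serves to compute n + n^2 in register 4. At the end, the cell before the free
    memory holds the cost d of the last record, and 1 - (d - k) decides d <= k. *)
Definition fast_prog :=
  Seq (double_sum (Const 0)) (Seq (Assign 6 (Reg 4)) (Seq
    (Assign 7 (Add (Reg 4) (Add (Reg 0) (Const 1)))) (Seq
    (While (Sub (Reg 0) (Reg 8)) stage_prog)
    (Assign 0 (Sub (Const 1)
      (Sub (Mem (Sub (Reg 7) (Const 1))) (Reg 1))))))).

(** * Arithmetic forms of the set conditions *)

Section Sums.
Variables (n : nat) (e : rel 'I_n) (S : {set 'I_n}).
Implicit Types X Y : {set 'I_n}.

Lemma narcs_sum (A B : {set 'I_n}) :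
  narcs e A B =
  \sum_(u < n) \sum_(v < n) ((u \in A) + ((v \in B) + e u v) - 2).
Proof.
rewrite /narcs big_mkcond; apply: eq_bigr => u _; rewrite big_mkcond.
case: (u \in A); last first.
  by rewrite big1 // => v _; case: (v \in B) (e u v) => [] [].
by apply: eq_bigr => v _; case: (v \in B) (e u v) => [] [].
Qed.

Lemma back_sum X Y :
  \sum_(u < n) \sum_(v < n) ((u \in Y) - (u \in X) + ((v \in X) + e u v) - 2) =
  back e X Y.
Proof.
rewrite /back narcs_sum; apply: eq_bigr => u _; apply: eq_bigr => v _.
by rewrite in_setD; case: (u \in X) (u \in Y) => [] [].
Qed.

(** The bit of u in [upto n j :\: Y] is 1 - ((u in Y) + (u - j)), as u - j vanishes exactly for u <=
    j. *)
Lemma cut_sum j Y :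
  \sum_(u < n) \sum_(v < n)
    (1 - ((u \in Y) + (u - j)) + ((v \in Y) + e u v) - 2) =
  narcs e (upto n j :\: Y) Y.
Proof.
rewrite narcs_sum; apply: eq_bigr => u _; apply: eq_bigr => v _.
rewrite in_setD inE -subn_eq0; congr (_ + _ - _).
by case: (u \in Y) (u - j) => [] [|m].
Qed.

(** The first difference detects a vertex of [X] missing in [Y]. The rest is the conjunction of four
    bits: u and v lie in the increment, u is in [S], and u differs from v, the last being 1 - (1 -
    |u - v|). *)
Lemma viol_sum X Y :
  (\sum_(u < n) \sum_(v < n) ((u \in X) - (u \in Y) +
    ((u \in Y) - (u \in X) + ((v \in Y) - (v \in X)) +
      ((u \in S) + (1 - (1 - ((u - v) + (v - u))))) - 3)) == 0) = okstep S X Y.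
Proof.
rewrite sum_nat_eq0; apply/forallP/okstepP => [viol|[XY ok] u /=].
  have {}viol u v : (u \in X) - (u \in Y) +
      ((u \in Y) - (u \in X) + ((v \in Y) - (v \in X)) +
        ((u \in S) + (1 - (1 - ((u - v) + (v - u))))) - 3) = 0.
    by have := viol u; rewrite /= sum_nat_eq0 => /forallP/(_ v)/eqP.
  split.
    apply/subsetP => u; have := viol u u.
    by case: (u \in X) (u \in Y) => [] [].
  move=> u v; rewrite !in_setD => /andP[/negbTE uX uY] /andP[/negbTE vX vY] uS.
  by apply: val_inj => /=; have := viol u v; rewrite uX uY vX vY uS /=; lia.
rewrite sum_nat_eq0; apply/forallP => v /=.
have := ok u v; have := subsetP XY u; rewrite !in_setD.
case: (u \in X) => [/(_ isT) -> _|_] /=.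
  by case: (v \in Y) (v \in X) (u \in S) => [] [] [] /=; lia.
case: (u \in Y) => /= [|_]; last first.
  by case: (v \in Y) (v \in X) (u \in S) => [] [] [] /=; lia.
case: (v \in Y) (v \in X) (u \in S) => [] [] [] /=; try by lia.
by move=> /(_ isT isT isT) ->; lia.
Qed.

End Sums.

(** * Records in memory and loop invariants *)

Section Correctness.
Variables (n : nat) (e : rel 'I_n) (S : {set 'I_n}) (k : nat).
Implicit Types (X Y : {set 'I_n}) (m : nat -> nat).
Implicit Types (xs : seq ({set 'I_n} * nat)).

Definition stored m a X := forall u : 'I_n, m (a + u) = (u \in X).

Definition matrix m :=
  stored m 0 S /\ forall u v : 'I_n, m (n + (n * u + v)) = e u v.

Definition adr i := n + n * n + i * n.+1.

Definition rep m xs := forall i, i < size xs ->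
  stored m (adr i) (nth (set0, 0) xs i).1 /\
  m (adr i + n) = (nth (set0, 0) xs i).2.

Lemma matrix_frame m m' a : matrix m -> n + n * n <= a ->
  (forall b, b < a -> m' b = m b) -> matrix m'.
Proof.
case=> mS mT na mm'; split=> [u|u v].
  by rewrite mm' ?mS; have := ltn_ord u; lia.
by rewrite mm' ?mT //; have := ltn_ord u; have := ltn_ord v; nia.
Qed.

Lemma adr_le i j : i < j -> adr i + n < adr j.
Proof. by rewrite /adr => ij; have := leq_mul ij (leqnn n.+1); lia. Qed.

Lemma rep_frame m m' xs : rep m xs ->
  (forall b, b < adr (size xs) -> m' b = m b) -> rep m' xs.
Proof.
move=> mxs mm' i ixs; have [Xi di] := mxs i ixs; have := adr_le ixs => adri.
split=> [u|]; last by rewrite mm'.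
by rewrite mm' ?Xi //; have := ltn_ord u; lia.
Qed.

Lemma rep_rcons m xs Y d : rep m xs -> stored m (adr (size xs)) Y ->
  m (adr (size xs) + n) = d -> rep m (rcons xs (Y, d)).
Proof.
move=> mxs mY md i; rewrite size_rcons ltnS leq_eqVlt nth_rcons.
by case: eqP => [->|_ /= /[dup] ixs ->]; [rewrite ltnn|apply: mxs].
Qed.

Lemma runs_copy j X s0 : regs s0 0 = n -> regs s0 8 = j ->
  regs s0 10 + n <= regs s0 7 ->
  stored (memory s0) (regs s0 10) X -> X \subset under n j ->
  runs copy_prog s0 (100 * n.+1)
    (fun s => [/\ forall r, r != 2 -> regs s r = regs s0 r,
      forall b, b < regs s0 7 -> memory s b = memory s0 b
      & stored (memory s) (regs s0 7) (insert j X)]).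
Proof.
move=> s0n s0j le_p s0X Xj.
pose I i s := [/\ forall r, r != 2 -> regs s r = regs s0 r, regs s 2 = i,
  forall b, b < regs s0 7 -> memory s b = memory s0 b
  & forall u : 'I_n, u < i -> memory s (regs s0 7 + u) = (u \in insert j X)].
apply: (@runs_weaken _ _ _ _ (I n)); last first.
  by move=> s [? _ ? sX]; split=> // u; apply: sX.
all: cycle 1.
  rewrite /copy_prog; apply: runs_seq; apply: runs_assign.
  apply: runs_while => [i s ltin [sr s2 sm sY]|s [sr s2 _ _]|].
  - split; first by rewrite /= sr // s0n s2; lia.
    apply: runs_seq; apply: runs_store; apply: runs_assign.
    rewrite /= (sr 7) // (sr 8) // (sr 10) // s2 s0j.
    split; rewrite /= /update /=.
    + by move=> r r2; rewrite (negbTE r2) sr.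
    + by rewrite addn1.
    + by move=> b lt_b; rewrite ifN ?sm //; lia.
    + move=> u; rewrite eqn_add2l ltnS leq_eqVlt.
      case: eqP => [ui _|_ /= ui]; last exact: sY.
      rewrite -ui sm; last by have := ltn_ord u; lia.
      rewrite s0X inE; have := subsetP Xj u.
      case: (u \in X) => [/(_ isT)|_] /=; first by rewrite inE; lia.
      by lia.
  - by rewrite /= sr // s0n s2; lia.
  - by split; rewrite /= /update //=; move=> r /negbTE ->.
rewrite /=; lia.
Qed.

Lemma runs_relax X Y s0 : regs s0 0 = n -> matrix (memory s0) ->
  stored (memory s0) (regs s0 7) Y -> stored (memory s0) (regs s0 11) X ->
  runs relax_prog s0 (200 * n.+1 ^ 2)
    (fun s => [/\ forall r, (r < 2) || (5 < r < 11) -> regs s r = regs s0 r,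
      memory s = memory s0, regs s 11 = regs s0 11 + n.+1
      & regs s 12 = relax e S Y (regs s0 12) (X, memory s0 (regs s0 11 + n))]).
Proof.
move=> s0n [s0S s0T] s0Y s0X.
pose d := memory s0 (regs s0 11 + n).
pose R s := [/\ forall r, (r < 2) || (5 < r < 12) -> regs s r = regs s0 r,
  memory s = memory s0 & regs s 12 = relax e S Y (regs s0 12) (X, d)].
rewrite /relax_prog; apply: runs_le.
  apply: runs_seq; apply: runs_assign; apply: runs_seq.
  apply: runs_imp.
    apply: (runs_double_sum (g := fun u v => (u \in X) - (u \in Y) +
      ((u \in Y) - (u \in X) + ((v \in Y) - (v \in X)) +
      ((u \in S) + (1 - (1 - ((u - v) + (v - u))))) - 3))) => //.
    move=> s u v [/= sr sm] s2 s3 _.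
    by rewrite /= sm s2 s3 !sr //= /update /= !s0X !s0Y -{1}[u : nat]add0n s0S.
  move=> s [[sr sm] _]; rewrite /= /update /= add0n => s5.
  have {s5} sok : (regs s 5 == 0) = okstep S X Y by rewrite s5 viol_sum.
  have {}sr r : (r < 2) || (5 < r) -> regs s r = regs s0 r.
    by move=> hr; rewrite sr //=; move: r hr => [|[|[|[|[|[|r]]]]]].
  rewrite /= in sm; apply: runs_seq.
  apply: (@runs_imp _ _ _ R).
    apply: (@runs_if _ _ _ _ (100 * n.+1 ^ 2)) => /= s5.
      apply: runs_le; [apply: runs_skip|by nia].
      split=> // [r hr|]; first by apply: sr; lia.
      by rewrite sr // /relax -sok (negbTE s5).
    apply: runs_le.
      apply: runs_seq; apply: runs_assign; apply: runs_seq.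
      apply: runs_imp.
        apply: (runs_double_sum (g := fun u v =>
          (u \in Y) - (u \in X) + ((v \in X) + e u v) - 2)).
          by rewrite /= /update /= sr.
        move=> s' u v [/= sr' sm'] s2 s3 s4.
        rewrite /= sm' sm s2 s3 s4 !sr' //= /update /= !sr // !s0X !s0Y s0T.
        by [].
      move=> s' [[sr' sm'] _]; rewrite back_sum /= {1}/update /= => s5'.
      rewrite /= in sr' sm'.
      have {}s5' : regs s' 5 = d + back e X Y.
        by rewrite s5' /d sm !sr // s0n.
      have {}sr' r : (r < 2) || (5 < r) -> regs s' r = regs s0 r.
        move=> hr; rewrite sr' //= /update; case: eqP hr => [-> //|_ hr].
        by rewrite sr.
      apply: (@runs_if _ _ _ _ 2) => /=; rewrite sr' // s5' => ltd.
        apply: runs_le; [apply: runs_assign|by []].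
        split; rewrite /= /update //= ?sm' //.
          by move=> r hr; rewrite ifN ?sr' //; lia.
        rewrite s5' /relax /= -sok s5 /= ifT //; lia.
      apply: runs_le; [apply: runs_skip|by []].
      split=> // [r hr||]; [by apply: sr'; lia|by rewrite sm'|].
      rewrite sr' // /relax /= ifF //; lia.
    rewrite /=; nia.
  move=> s' [sr' sm' s12]; apply: runs_assign; split=> //=; rewrite /update /=.
  + by move=> r hr; rewrite ifN ?sr' //; lia.
  + by rewrite !sr' // s0n; lia.
rewrite /=; nia.
Qed.

Lemma runs_best xs Y s0 : regs s0 0 = n -> regs s0 1 = k ->
  regs s0 6 = adr 0 -> regs s0 7 = adr (size xs) -> matrix (memory s0) ->
  rep (memory s0) xs -> stored (memory s0) (adr (size xs)) Y ->
  runs best_prog s0 (300 * n.+1 ^ 2 * (size xs).+1)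
    (fun s => [/\ forall r, (r < 2) || (5 < r < 11) -> regs s r = regs s0 r,
      memory s = memory s0 & regs s 12 = best e S k xs Y]).
Proof.
move=> s0n s0k s06 s07 s0mat s0xs s0Y.
pose I i s := [/\ forall r, (r < 2) || (5 < r < 11) -> regs s r = regs s0 r,
  memory s = memory s0, regs s 11 = adr i
  & regs s 12 = best e S k (take i xs) Y].
rewrite /best_prog; apply: runs_le.
  do 2![apply: runs_seq; apply: runs_assign].
  apply: (@runs_imp _ _ _ (I (size xs))) => [|s [? ? _]]; last first.
    by rewrite take_size.
  apply: runs_while => [i s ixs [sr sm s11 s12]|s [sr _ s11 _]|].
  - split; first by rewrite /= sr // s07 s11; have := adr_le ixs; lia.
    have [s0X s0d] := s0xs i ixs.
    apply: runs_imp.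
      apply: (runs_relax (X := (nth (set0, 0) xs i).1) (Y := Y));
        rewrite ?sm //.
      + by rewrite sr.
      + by rewrite sr // s07.
      + by rewrite s11.
    move=> s' [sr' sm' s11' s12']; split.
    + by move=> r hr; rewrite sr' // sr.
    + by rewrite sm'.
    + by rewrite s11' s11 /adr mulSn; lia.
    + rewrite s12' s12 sm s11 s0d (take_nth (set0, 0)) // best_rcons.
      by case: (nth _ _ _).
  - by rewrite /= sr // s07 s11 subnn.
  - split; rewrite /= /update //=; first by move=> r hr; rewrite !ifN //; lia.
    by rewrite s0k take0 addn1.
rewrite /=; nia.
Qed.

Definition extending j i s := exists xs, [/\ [/\ regs s 0 = n, regs s 1 = k,
    regs s 6 = adr 0 & regs s 7 = adr (size xs)],
    [/\ regs s 8 = j, regs s 9 = adr (size (domain e k j)) & regs s 10 = adr i],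
    matrix (memory s) /\ rep (memory s) xs
  & table e S k xs /\
    unzip1 xs = domain e k j ++ extend e k j (take i (domain e k j))].

Lemma extend_rcons j Xs X : extend e k j (rcons Xs X) =
  if cutok e k j (insert j X) then rcons (extend e k j Xs) (insert j X)
  else extend e k j Xs.
Proof. by rewrite /extend map_rcons filter_rcons. Qed.

Lemma runs_extend j i s0 : j < n -> i < size (domain e k j) ->
  extending j i s0 ->
  runs extend_prog s0 (1000 * n.+1 ^ 2 * (size (domain e k n)).+1)
    (extending j i.+1).
Proof.
move=> jn iXs [xs [[s0n s0k s06 s07] [s08 s09 s010] [s0mat s0xs] [txs xsE]]].
set Xs := domain e k j in iXs s09 xsE *; pose X := nth set0 Xs i.
have sizexs : size xs <= size (domain e k n).
  by rewrite -(size_map fst) -/(unzip1 xs) xsE extend_take.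
have ixs : i < size xs.
  by rewrite -(size_map fst) -/(unzip1 xs) xsE size_cat; lia.
have xsX : (nth (set0, 0) xs i).1 = X.
  by rewrite -(nth_map _ set0 fst) // -/(unzip1 xs) xsE nth_cat iXs.
have Xj : X \subset under n j by apply: (@domain_under _ e k); apply: mem_nth.
have [s0X _] := s0xs i ixs; rewrite xsX in s0X.
rewrite /extend_prog; apply: runs_le.
  apply: runs_seq; apply: runs_imp.
    apply: (runs_copy (j := j) (X := X)) => //; last by rewrite s010.
    by rewrite s07 s010; have := adr_le ixs; lia.
  rewrite s07 => s1 [s1r s1m s1Y]; set Y := insert j X in s1Y.
  have s1mat : matrix (memory s1).
    by apply: matrix_frame s0mat _ s1m; rewrite /adr leq_addr.
  have {s1m} s1xs : rep (memory s1) xs by apply: rep_frame s0xs s1m.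
  apply: runs_seq; apply: runs_assign; apply: runs_seq; apply: runs_imp.
    apply: (runs_double_sum (n := n) (g := fun u v =>
      1 - ((u \in Y) + (u - j)) + ((v \in Y) + e u v) - 2)).
      by rewrite /= /update /= s1r.
    move=> s u v [/= sr sm] s2 s3 s4.
    rewrite /= sm s2 s3 s4 !sr //= /update /= !s1r //.
    by rewrite s08 s07 !s1Y s1mat.2.
  move=> s2 [[/= s2r s2m] _]; rewrite cut_sum /= {1}/update /= add0n => s25.
  have {}s2r r : (r < 2) || (5 < r) -> regs s2 r = regs s0 r.
    by move=> hr; rewrite s2r //= /update ifN ?s1r //; lia.
  rewrite -s2m in s1Y s1mat s1xs; clear s2m s1r s1.
  (* This is [extending j i.+1] except that register 10 has not yet moved to the next record. *)
  apply: runs_seq; apply: (@runs_imp _ _ _ (fun s => exists xs, [/\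
      [/\ regs s 0 = n, regs s 1 = k, regs s 6 = adr 0
        & regs s 7 = adr (size xs)],
      [/\ regs s 8 = j, regs s 9 = adr (size (domain e k j))
        & regs s 10 = adr i],
      matrix (memory s) /\ rep (memory s) xs & table e S k xs /\
        unzip1 xs = Xs ++ extend e k j (take i.+1 Xs)])).
    rewrite (take_nth set0) // extend_rcons -/X -/Y.
    apply: (@runs_if _ _ _ _ (310 * n.+1 ^ 2 * (size (domain e k n)).+1)) => /=.
      rewrite s25 s2r // s0k => cutY; apply: runs_le; [apply: runs_skip|by nia].
      exists xs; split=> //; first by rewrite !s2r.
        by rewrite !s2r.
      by rewrite /cutok ifN //; lia.
    rewrite s25 s2r // s0k => cutY; apply: runs_le.
      apply: runs_seq; apply: runs_imp.
        by apply: (runs_best (xs := xs) (Y := Y)); rewrite ?s2r.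
      move=> s3 [s3r s3m s312].
      have {}s3r r : (r < 2) || (5 < r < 11) -> regs s3 r = regs s0 r.
        by move=> hr; rewrite s3r ?s2r //; lia.
      apply: runs_seq; apply: runs_store; apply: runs_assign.
      exists (rcons xs (Y, best e S k xs Y)).
      rewrite /= /update /= s312 s3m !s3r // s0n s07 s0k s06 s08 s09 s010.
      have frame b : b < adr (size xs) + n ->
          (if b == adr (size xs) + n then best e S k xs Y else memory s2 b) =
          memory s2 b.
        by move=> ltb; rewrite ifN //; lia.
      split=> //.
      - by split=> //; rewrite size_rcons /adr mulSn; lia.
      - split.
          by apply: matrix_frame s1mat _ frame; rewrite /adr; lia.
        apply: rep_rcons; last by rewrite eqxx.
          by apply: rep_frame s1xs _ => b ltb; apply: frame; lia.
        by move=> u; rewrite frame ?s1Y //; have := ltn_ord u; lia.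
      - split.
          apply: tableS => //; apply/negP => /hasP[x xxs]; apply/negP.
          apply: (@sorted_subsets_insert _ e k) => //; rewrite -/Xs -xsE.
          exact: map_f.
        rewrite /unzip1 map_rcons -/(unzip1 xs) xsE rcons_cat /cutok ifT //.
        by rewrite -subn_eq0 cutY.
    rewrite /=; nia.
  move=> s [ys [[sn sk s6 s7] [s8 s9 s10] smem sys]]; apply: runs_assign.
  exists ys; rewrite /= /update /= sn sk s6 s7 s8 s9 s10.
  by split=> //; split=> //; rewrite /adr mulSn; lia.
rewrite /=; nia.
Qed.

Definition staging j s := exists xs, [/\ [/\ regs s 0 = n, regs s 1 = k,
    regs s 6 = adr 0 & regs s 7 = adr (size xs)], regs s 8 = j,
    matrix (memory s) /\ rep (memory s) xs
  & table e S k xs /\ unzip1 xs = domain e k j].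

Lemma runs_stage j s0 : j < n -> staging j s0 ->
  runs stage_prog s0 (1100 * n.+1 ^ 2 * (size (domain e k n)).+1 ^ 2)
    (staging j.+1).
Proof.
move=> jn [xs [[s0n s0k s06 s07] s08 [s0mat s0xs] [txs xsE]]].
set Xs := domain e k j in xsE.
have sXs : size Xs <= size (domain e k n) by apply/size_domain_mono/ltnW.
have sxs : size xs = size Xs by rewrite -(size_map fst) -/(unzip1 xs) xsE.
rewrite /stage_prog; apply: runs_le.
  do 2![apply: runs_seq; apply: runs_assign]; apply: runs_seq.
  apply: (@runs_imp _ _ _ (extending j (size Xs))).
    apply: runs_while => [i s ixs si||].
    - split; last exact: runs_extend.
      case: si => ys [_ [_ s9 s10] _ _].
      by rewrite /= s9 s10 -/Xs; have := adr_le ixs; lia.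
    - by move=> s [ys [_ [_ s9 s10] _ _]]; rewrite /= s9 s10 subnn.
    - exists xs; rewrite /= /update /= take0 cats0; split=> //.
      by rewrite s08 s07 sxs.
  move=> s [ys [[sn sk s6 s7] [s8 _ _] smem]]; rewrite take_size => sys.
  by apply: runs_assign; exists ys; rewrite /= /update /= s8 addn1.
rewrite /=; nia.
Qed.

(** The cells of [S] lie below n and those of the matrix do not; within the matrix, division by n
    recovers the row, then the column. *)
Lemma matrix_input : matrix (memory (input e S k)).
Proof.
have divE (u v i j : 'I_n) :
    (n + (n * u + v) == n + (n * i + j)) = (u == i) && (v == j).
  rewrite eqn_add2l; apply/eqP/andP => [|[/eqP -> /eqP ->] //].
  have n0 : 0 < n by case: n u => [[]|].
  move=> uvij; have ui : u = i :> nat.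
    have := congr1 (divn^~ n) uvij.
    by rewrite /= !(mulnC n) !divnMDl // !divn_small // !addn0.
  by split; apply/eqP/val_inj => //=; move: uvij; rewrite ui => /addnI.
split=> [u|u v] /=; congr nat_of_bool.
  rewrite add0n; apply/orP/idP => [[/existsP[i /andP[/eqP/val_inj -> //]]|]|uS].
    by case/existsP=> i /existsP[j /andP[/eqP]]; have := ltn_ord u; lia.
  by left; apply/existsP; exists u; rewrite eqxx.
apply/orP/idP => [[/existsP[i /andP[/eqP]]|]|euv].
- by have := ltn_ord i; lia.
- case/existsP=> i /existsP[j /andP[]].
  by rewrite divE => /andP[/eqP -> /eqP ->].
- by right; apply/existsP; exists u; apply/existsP; exists v; rewrite eqxx.
Qed.

Lemma input_blank a : n + n * n <= a -> memory (input e S k) a = 0.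
Proof.
move=> na; apply/eqP; rewrite /= eqb0 negb_or; apply/andP; split.
  by apply/existsP => [[i /andP[/eqP]]]; have := ltn_ord i; nia.
apply/existsP => [[i /existsP[j /andP[/eqP aE _]]]].
by have := ltn_ord i; have := ltn_ord j; nia.
Qed.

Lemma runs_fast : tournament e ->
  runs fast_prog (input e S k)
    (1200 * n.+1 ^ 3 * (size (domain e k n)).+1 ^ 2)
    (fun s => (subset_FAST e S k -> regs s 0 = 1) /\
              (~ subset_FAST e S k -> regs s 0 = 0)).
Proof.
case=> irr _; rewrite /fast_prog; apply: runs_le.
  apply: runs_seq; apply: runs_imp.
    by apply: (runs_double_sum (n := n) (g := fun _ _ => 0)).
  move=> s [[sr sm] s4 _]; do 2![apply: runs_seq; apply: runs_assign].
  apply: runs_seq; apply: (@runs_imp _ _ _ (staging n)).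
    apply: runs_while => [j s' jn sj||].
    - split; last exact: runs_stage.
      by case: sj => ys [[sn _ _ _] s8 _ _]; rewrite /= sn s8; lia.
    - by move=> s' [ys [[sn _ _ _] s8 _ _]]; rewrite /= sn s8 subnn.
    (* Blank memory already encodes the empty set with cost 0. *)
    - exists [:: (set0, 0)]; rewrite /= /update /= s4 sm !sr //; split=> //.
      + by split=> //=; rewrite /adr /=; lia.
      + split; first exact: matrix_input.
        by case=> // _; split=> [u|]; rewrite input_blank ?inE // /adr; lia.
      + by split; first exact: table1.
  move=> s' [xs [[sn sk _ s7] _ [_ sxs] [txs xsE]]].
  apply: runs_assign; rewrite /= /update /= s7 sk.
  case/lastP: xs txs xsE sxs s7 => [|xs [X d]] txs xsE sxs s7.
    by have := setT_domain e k; rewrite -xsE.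
  have XT : X = setT.
    by rewrite -(last_domain e k) -xsE /unzip1 map_rcons last_rcons.
  have [|_] := sxs (size xs); first by rewrite size_rcons.
  rewrite nth_rcons ltnn eqxx /= => md.
  have -> : adr (size (rcons xs (X, d))) - 1 = adr (size xs) + n.
    by rewrite size_rcons /adr mulSn; lia.
  rewrite md; have : subset_FAST e S k <-> d <= k.
    apply: (table_correct irr txs).
      move=> Z kZ; rewrite xsE; have := domain_complete kZ (leqnn n).
      rewrite (_ : under n n = setT) ?setIT //.
      by apply/setP => u; rewrite !inE ltn_ord.
    by rewrite -XT mem_rcons mem_head.
  case=> fd df; split=> [/fd|nf]; first by lia.
  by have : ~~ (d <= k) by [apply/negP => /df]; lia.
rewrite /=; nia.
Qed.

End Correctness.

(** * Running time *)

Lemma sqrt_witness m : exists2 s, s * s <= m & forall r, r * r <= m -> r <= s.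
Proof.
have ex : exists r, r * r <= m by exists 0.
have ub r : r * r <= m -> r <= m by move=> h; nia.
by exists (ex_maxn ex ub); case: ex_maxnP.
Qed.

(** For k <= 1 the exponent sqrt k * ln k vanishes, so the polynomial must absorb everything: s <= 2
    and the base is at most 6. *)
Lemma time_split_small c n k s : k <= 1 -> s * s <= 8 * k ->
  c * n.+1 ^ 7 * ((4 * k + 2) ^ s) ^ 2 <= c * 36 * 36 * n.+1 ^ 7.
Proof.
move=> k1 s8; have s2 : s <= 2 by nia.
have M : (4 * k + 2) ^ s <= 36.
  apply: (@leq_trans (6 ^ s)); last by case: s {s8} s2 => [|[|[|]]].
  by case: s s8 s2 => // s _ _; rewrite leq_exp2r; lia.
have -> : c * 36 * 36 * n.+1 ^ 7 = c * n.+1 ^ 7 * 36 ^ 2.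
  by rewrite -!mulnA mulnC; lia.
by rewrite leq_mul2l leq_exp2r // M orbT.
Qed.

(** The product xy is at most x^2 + y^2, and 4k + 2 <= k^4 for k >= 2, so y^2, the power of 4k + 2
    to 4s, is at most k^(16s). *)
Lemma time_split c n k s : 1 < k ->
  c * n.+1 ^ 7 * ((4 * k + 2) ^ s) ^ 2 <= c * c * n.+1 ^ 14 + k ^ (16 * s).
Proof.
move=> k2; set x := c * _; set y := _ ^ 2.
have -> : c * c * n.+1 ^ 14 = x * x by rewrite /x mulnACA -expnD.
apply: (@leq_trans (x * x + y * y)); first by have [+ _] := nat_Cauchy x y; nia.
rewrite leq_add2l /y mulnn -!expnM.
have -> : 16 * s = 4 * (s * (2 * 2)) by lia.
rewrite [leqRHS]expnM; case: (posnP (s * (2 * 2))) => [->//|s0].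
rewrite leq_exp2r //.
have k8 : 2 ^ 3 <= k ^ 3 by rewrite leq_exp2r.
by rewrite expnSr; have := leq_mul k8 (leqnn k); lia.
Qed.

(** Squaring the bound 2(n + 1)^2 M on the table size gives the factor 4 and the exponent 3 + 4 =
    7. *)
Lemma runs_fast_cuts n (e : rel 'I_n) S k s : tournament e ->
  (forall r, r * r <= 8 * k -> r <= s) ->
  runs fast_prog (input e S k) (1200 * 4 * n.+1 ^ 7 * ((4 * k + 2) ^ s) ^ 2)
    (fun s' => (subset_FAST e S k -> regs s' 0 = 1) /\
               (~ subset_FAST e S k -> regs s' 0 = 0)).
Proof.
move=> te le_s; apply: runs_le (runs_fast S k te) _.
have N : (size (domain e k n)).+1 <= 2 * (n.+1 ^ 2 * (4 * k + 2) ^ s).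
  have := size_domain te le_s; have : 0 < n.+1 ^ 2 * (4 * k + 2) ^ s.
    by rewrite muln_gt0 !expn_gt0; lia.
  by rewrite -mulnn; lia.
apply: (@leq_trans (1200 * n.+1 ^ 3 * (2 * (n.+1 ^ 2 * (4 * k + 2) ^ s)) ^ 2)).
  by rewrite leq_mul2l leq_exp2r // N orbT.
have -> : n.+1 ^ 7 = n.+1 ^ 3 * (n.+1 ^ 2 * n.+1 ^ 2) by rewrite -!expnD.
apply: eq_leq; rewrite -[(2 * _) ^ 2]mulnn -[(_ ^ s) ^ 2]mulnn.
by move: 1200 (n.+1 ^ 3) (n.+1 ^ 2) (_ ^ s) => c x y z; lia.
Qed.

From mathcomp Require Import all_boot all_order all_algebra.
From mathcomp Require Import all_classical all_reals all_analysis.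
From mathcomp Require Import ring.
Import Order.TTheory GRing.Theory Num.Theory.

(** * The exponential term over the reals *)

Section Real.
Variable R : realType.
Local Open Scope ring_scope.

(** This is ln(1 + x) <= x at x = -1/2. *)
Lemma ln2_ge_half : 2^-1 <= ln 2 :> R.
Proof.
have := @le_ln1Dx R (- 2^-1).
have -> : 1 + - 2^-1 = 2^-1 :> R by rewrite {1}(splitr 1) div1r addrK.
rewrite lnV ?posrE // lerN2; apply.
by rewrite ltrN2 invf_lt1 // ltr1n.
Qed.

(** Since s <= 3 sqrt k, the exponent 16 s ln k is at most 48 sqrt k ln k; passing to base 2 doubles
    the constant, by [ln2_ge_half]. *)
Lemma exp_absorb k s : (s * s <= 8 * k)%N -> (1 < k)%N ->
  (k ^ (16 * s))%:R <= 2 `^ (96%:R * (Num.sqrt k%:R * ln k%:R)) :> R.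
Proof.
move=> s8 k2.
have k0 : 0 < k%:R :> R by rewrite ltr0n; lia.
have lnk : 0 <= ln k%:R :> R by rewrite ln_ge0 // ler1n; lia.
have sk : s%:R <= 3 * Num.sqrt k%:R :> R.
  rewrite -(@ler_pXn2r _ 2) ?nnegrE ?mulr_ge0 ?sqrtr_ge0 //.
  rewrite exprMn sqr_sqrtr ?(ltW k0) // -!natrX -natrM ler_nat.
  by rewrite -mulnn; lia.
rewrite natrX -(@lnK _ (k%:R)) ?posrE // -expRM_natl /powR ifF; last first.
  by apply/negbTE; rewrite pnatr_eq0.
rewrite ler_expR lnK ?posrE //.
rewrite natrM -mulrA.
apply: (@le_trans _ _ (96%:R * (Num.sqrt k%:R * ln k%:R) * 2^-1)); last first.
  by rewrite ler_wpM2l ?ln2_ge_half // !mulr_ge0 // sqrtr_ge0.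
apply: (@le_trans _ _ (16%:R * (3 * Num.sqrt k%:R * ln k%:R))).
  by rewrite ler_wpM2l // ler_wpM2r.
have -> : 96%:R = 16%:R * 3 * 2 :> R by rewrite -!natrM.
by rewrite le_eqVlt; apply/orP; left; apply/eqP; field.
Qed.
End Real.

Theorem theorem2 (R : realType) :
  exists (p : prog) (a b : nat),
    forall (n : nat) (T : rel 'I_n) (S : {set 'I_n}) (k : nat),
      tournament T ->
      exists (s : state) (t : nat),
        [/\ exec p (input T S k) s t,
            subset_FAST T S k -> regs s 0 = 1,
            ~ subset_FAST T S k -> regs s 0 = 0
          & (t%:R <= 2 `^ (a%:R * (Num.sqrt k%:R * ln k%:R))
                     + (b * n.+1 ^ b)%:R :> R)%R].
Proof.
have [c cE] : exists c, c = 1200 * 4 by exists (1200 * 4).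
(* [b] dominates the coefficients c * 36 * 36 and c * c and the exponents 7 and 14 of the two
   cases. *)
pose b := c * 36 * 36 + c * c + 14.
exists fast_prog, 96, b => n T S k tT.
have [r r8 le_r] := sqrt_witness (8 * k).
have [s [t []]] := runs_fast_cuts S tT le_r; rewrite -cE => ex tB [yes no].
exists s, t; split=> //.
have [k2|k1] := ltnP 1 k.
  have : t <= b * n.+1 ^ b + k ^ (16 * r).
    apply: leq_trans tB (leq_trans (time_split c n r k2) _).
    by rewrite leq_add2r leq_mul ?leq_pexp2l //; rewrite /b; lia.
  rewrite -(ler_nat R) natrD addrC => /le_trans; apply.
  by rewrite lerD2r; apply: exp_absorb.
have : t <= b * n.+1 ^ b.
  apply: leq_trans tB (leq_trans (time_split_small c n k1 r8) _).
  by rewrite leq_mul ?leq_pexp2l //; rewrite /b; lia.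
rewrite -(ler_nat R) => /le_trans; apply.
by rewrite lerDr powR_ge0.
Qed.
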